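(* Let $X$ be an uncountable abelian Polish group. Then every countable subset of $X$ is Haar-$1$.
   Context: A subset $A$ of an abelian Polish group $X$ is Haar-$1$ if there are a Borel set $B\subseteq X$ with $A\subseteq B$ and a homeomorphic copy $C\subseteq X$ of $2^\omega$ such that $|(C+x)\cap B|\leq 1$ for all $x\in X$. *)

(* Defs.v *)
From mathcomp Require Import all_boot all_order all_algebra.
From mathcomp Require Import all_classical all_reals all_analysis.

Set Implicit Arguments.
Unset Strict Implicit.
Unset Printing Implicit Defensive.

Local Open Scope classical_set_scope.
Local Open Scope ring_scope.

Definition homeomorphic (T U : topologicalType) : Prop :=
  exists (f : T -> U) (g : U -> T),
    [/\ cancel f g, cancel g f, continuous f & continuous g].

Definition separable (T : topologicalType) : Prop :=
  exists2 D : set T, countable D & dense D.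

Definition complete_metric (R : realType) (M : metricType R) : Prop :=
  forall u : nat -> M, cauchy (u @ \oo) -> exists l : M, u @ \oo --> l.

Definition completely_metrizable (R : realType) (T : topologicalType) : Prop :=
  exists2 M : metricType R, complete_metric M & homeomorphic T M.

Definition polish (R : realType) (T : topologicalType) : Prop :=
  separable T /\ completely_metrizable R T.

Definition borel_set (T : topologicalType) (B : set T) : Prop :=
  <<s [set U : set T | open U] >> B.

(* [C : Type] is the subtype of the points of [C], with the subspace topology. *)
Definition cantor_copy (T : topologicalType) (C : set T) : Prop :=
  homeomorphic cantor_space (C : Type).

(* [is_subset1 S] says that [S] has at most one element. *)
Definition haar1 (X : topologicalZmodType) (A : set X) : Prop :=
  exists B C : set X,
    [/\ borel_set B, A `<=` B, cantor_copy C &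
        forall x : X, is_subset1 ([set c + x | c in C] `&` B)].

(* Main.v *)
(* Choose x_0, x_1, ... in X inductively so that every sum of the x_i with
   coefficients in {-1, 0, 1}, not all zero, avoids the countable set
   Q = (A - A) `|` {0}, and take for C the set of the sums of e_i x_i, e in
   2^nat. The choice of x_n is possible since neighbourhoods of 0 are
   uncountable while only countably many values are forbidden, so x_n can be
   taken small with respect to the finitely many earlier signed sums and their
   distances to the first n points of Q. The complete metric of X need not be
   translation invariant, hence smallness is required at each of these sums: it
   makes the series converge and keeps their limits off Q. The difference of
   two distinct points of C is such a limit, so at most one of them can be
   translated into A by a given x. *)
Require Import Defs.
From mathcomp Require Import all_boot all_order all_algebra.
From mathcomp Require Import all_classical all_reals all_analysis.
From mathcomp Require Import lra.
Import Order.TTheory GRing.Theory Num.Theory.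

Set Implicit Arguments.
Unset Strict Implicit.
Unset Printing Implicit Defensive.

Local Open Scope classical_set_scope.
Local Open Scope ring_scope.

(** * Countable sets as Borel sets, and embedded Cantor spaces *)

Lemma countable_borel (T : topologicalType) (A : set T) :
  hausdorff_space T -> countable A -> borel_set A.
Proof.
move=> hT cA; rewrite /borel_set.
have b1 (x : T) : <<s [set U : set T | open U] >> [set x].
  rewrite -[[set x]]setCK -setTD; apply: sigma_algebraCD.
  apply: sub_sigma_algebra; rewrite /=.
  apply: closed_openC; apply: accessible_closed_set1.
  exact: hausdorff_accessible.
have [->|[f]] := pfcard_geP cA; first exact: sigma_algebra0.
have -> : A = \bigcup_n [set f n].
  apply/seteqP; split => [y Ay|y [n _ ->]]; last exact: funS.
  by have [n _ <-] := @surj _ _ _ _ f y Ay; exists n.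
exact: sigma_algebra_bigcup.
Qed.

(** Closed subsets of the Cantor space are compact, so their images under [F] are compact, hence
    closed in the Hausdorff space [T]; this makes the inverse continuous. *)
Lemma cantor_copy_range (T : topologicalType) (F : cantor_space -> T) :
  hausdorff_space T -> continuous F -> injective F -> cantor_copy (range F).
Proof.
move=> hT cF iF.
pose f (e : cantor_space) : set_type (range F) := SigSub (mem_set (imageT F e)).
have fP (c : set_type (range F)) : exists e, F e = val c.
  by have [e _ <-] := set_valP c; exists e.
have [g gP] := choice fP.
have fK : cancel f g by move=> e; apply: iF; exact: gP.
have gK : cancel g f by move=> c; apply: val_inj; exact: gP.
exists f, g; split=> //.
  by apply: continuous_comp_initial.
apply/continuous_closedP => K clK.
have cK : compact K.
  by apply: (subclosed_compact clK cantor_space_compact).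
have -> : g @^-1` K = set_val @^-1` (F @` K).
  apply/seteqP; split => c /=.
    by move=> Kc; exists (g c).
  by move=> [e Ke ec]; rewrite -(iF _ _ (etrans ec (esym (gP c)))).
apply: closed_comp; first by move=> ? _; exact: initial_continuous.
apply: compact_closed => //; apply: continuous_compact => //.
exact: continuous_subspaceT.
Qed.

(** * Small elements outside a countable set *)

(** The translates of [U] by a countable dense set cover [X], so a countable [U] would make [X]
    countable. *)
Lemma nbhs0_uncountable (X : topologicalZmodType) (U : set X) :
  separable X -> ~ countable [set: X] -> nbhs 0 U -> ~ countable U.
Proof.
move=> [D cD dD] uX U0 cU; apply: uX.
apply: (@sub_countable _ _ _ (\bigcup_(d in D) \bigcup_(u in U) [set d + u]));
  last by do 2! apply: bigcup_countable => // ? _; exact: countable1.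
apply: subset_card_le => x _.
have : nbhs x [set y | U (x - y)].
  have : {for x, continuous (fun y : X => x - y)}.
    apply: (@continuous2_cvg _ _ _ _ _ _ _ _ (fun a b : X => a - b)).
    - exact: (@sub_continuous X (x, x)).
    - exact: cvg_cst.
    - exact: cvg_id.
  by move=> cx; apply: cx; rewrite subrr.
rewrite nbhsE => -[V [oV Vx] VU].
have [y [Vy Dy]] := dD V (ex_intro _ x Vx) oV.
by exists y => //; exists (x - y); [exact: VU|rewrite /= addrC subrK].
Qed.

Lemma near_countable (X : topologicalZmodType) (P : X -> Prop) (Q : set X) :
  separable X -> ~ countable [set: X] -> (\forall x \near (0 : X), P x) ->
  countable Q -> exists2 x, P x & ~ Q x.
Proof.
move=> sX uX P0 cQ; apply: contrapT => nPQ.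
apply: (nbhs0_uncountable sX uX P0).
apply: sub_countable cQ; apply: subset_card_le => x Px.
by apply: contrapT => nQ; apply: nPQ; exists x.
Qed.

Lemma near_seq (T : Type) (F : set_system T) (I : eqType) (s : seq I)
    (P : I -> T -> Prop) : Filter F ->
  {in s, forall i, \forall x \near F, P i x} ->
  \forall x \near F, {in s, forall i, P i x}.
Proof.
move=> FF; elim: s => [_|i s IHs sP]; first by apply: nearW.
have := IHs (fun j js => sP j (mem_behead (s := i :: s) js)).
have := sP i (mem_head _ _).
apply: filterS2 => x Pi Ps j; rewrite inE => /orP[/eqP->//|]; exact: Ps.
Qed.

Lemma ball_separate_seq (R : realType) (M : metricType R) (s : seq (M * M)) :
  {in s, forall p, p.1 <> p.2} ->
  exists2 e : R, 0 < e & {in s, forall p, ~ ball p.1 e p.2}.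
Proof.
elim: s => [_|p s IHs sP]; first by exists 1.
have [e e0 se] := IHs (fun j js => sP j (mem_behead (s := p :: s) js)).
have [e' pe] : exists e' : {posnum R}, ~ ball p.1 e'%:num p.2.
  apply/existsNP => pe; apply: (sP p (mem_head _ _)).
  by apply: close_eq; [exact: metric_hausdorff|rewrite ball_close].
exists (Num.min e e'%:num); first by rewrite lt_min e0 /=.
move=> q; rewrite inE => /orP[/eqP->|qs].
  by apply: contra_not pe; apply: le_ball; rewrite ge_min lexx orbT.
by apply: contra_not (se q qs); apply: le_ball; rewrite ge_min lexx.
Qed.

(** * Convergence with halving radii *)

Section halving.
Variables (R : realType) (M : pseudoMetricType R) (r : nat -> R) (u : nat -> M).
Hypothesis r0 : forall n, 0 < r n.
Hypothesis r_half : forall n, r n.+1 <= r n / 2.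
Hypothesis ur : forall n, ball (u n) (r n) (u n.+1).

Lemma halving_small (e : R) : 0 < e -> exists n, r n < e.
Proof.
move=> e0.
have rle n : r n <= r 0%N / 2 ^+ n.
  elim: n => [|n IHn]; first by rewrite expr0 divr1.
  apply: (le_trans (r_half n)); rewrite exprSr invfM mulrA.
  by rewrite ler_wpM2r.
have er0 : 0 < e / r 0%N by rewrite divr_gt0.
have [n _ /(_ n (leqnn n)) ne] := near_infty_natSinv_expn_lt (PosNum er0).
exists n; apply: (le_lt_trans (rle n)).
by move: ne; rewrite /= ltr_pdivlMr // mulrC mul1r.
Qed.

Lemma halving_ball n m : ball (u n) (2 * r n) (u (n + m)%N).
Proof.
elim: m n => [|m IHm] n.
  by rewrite addn0; apply: ballxx; rewrite mulr_gt0.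
(* The factor 2 is the sum of the geometric series: [2 * r n.+1 <= r n]. *)
apply: (@le_ball _ _ _ (r n + 2 * r n.+1)).
  by have := r_half n; lra.
by apply: (ball_triangle (ur n)); rewrite addnS -addSn.
Qed.

Lemma halving_cauchy : cauchy (u @ \oo).
Proof.
apply/cauchyP => e e0.
have [n rn] := halving_small (divr_gt0 e0 (ltr0n R 2)).
exists (u n); exists n => // m /= nm; rewrite -(subnKC nm).
by apply: le_ball (halving_ball n _); lra.
Qed.

Lemma halving_lim (l : M) : u @ \oo --> l ->
  forall n, ball (u n) (3 * r n) l.
Proof.
move=> ul n; move/cvg_ballP: ul => /(_ _ (r0 n)) [k _ kP].
have := kP (n + k)%N (leq_addl _ _).
(* A radius [2 * r n] reaches every later term, and one more [r n] leads from a late term to the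
   limit. *)
move/ball_sym => lu; apply: (@le_ball _ _ _ (2 * r n + r n)); first by lra.
exact: (ball_triangle (halving_ball n k)).
Qed.
End halving.

(** * Inductive choice of the summands *)

Section signed_sums.
Variables (R : realType) (X : topologicalZmodType) (M : metricType R).
Variables (h : X -> M) (d : nat -> X).
Hypotheses (h_cont : continuous h) (h_inj : injective h).
Hypotheses (X_sep : separable X) (X_unc : ~ countable [set: X]).

(** When [L] lists the signed sums of the earlier terms, these are the sums in which the new term
    [x] has coefficient 1 or -1. *)
Definition translates (L : seq X) (x : X) : seq X :=
  [seq v + x | v <- L] ++ [seq v - x | v <- L].

Lemma mem_translates (L : seq X) (x v : X) : v \in L ->
  v + x \in translates L x /\ v - x \in translates L x.
Proof.
move=> Lv; rewrite /translates !mem_cat; split.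
  by rewrite (map_f (fun v => v + x) Lv).
by rewrite (map_f (fun v => v - x) Lv) orbT.
Qed.

Lemma near_translate (v : X) (e : R) : 0 < e ->
  \forall x \near (0 : X), ball (h v) e (h (v + x)) /\ ball (h v) e (h (v - x)).
Proof.
move=> e0.
have cD : h (v + x) @[x --> (0 : X)] --> h v.
  apply: continuous_cvg; first exact: h_cont.
  rewrite -[X in _ --> X](addr0 v).
  apply: (@continuous2_cvg _ _ _ _ _ _ _ _ (fun a b : X => a + b)).
  - exact: (@add_continuous X (v, 0)).
  - exact: cvg_cst.
  - exact: cvg_id.
have cB : h (v - x) @[x --> (0 : X)] --> h v.
  apply: continuous_cvg; first exact: h_cont.
  rewrite -[X in _ --> X](subr0 v).
  apply: (@continuous2_cvg _ _ _ _ _ _ _ _ (fun a b : X => a - b)).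
  - exact: (@sub_continuous X (v, 0)).
  - exact: cvg_cst.
  - exact: cvg_id.
by near=> x; split; near: x; [move/cvg_ballP: cD|move/cvg_ballP: cB]; exact.
Unshelve. all: by end_near. Qed.

(** All [d k] are avoided, but a gap is demanded only for the finitely many [k <= n], so that a
    single positive radius [r'] suffices. *)
Lemma signed_sums_step (n : nat) (L N : seq X) (r : R) : 0 < r ->
    {in N, forall v k, v <> d k} ->
  exists (x : X) (r' : R), let N' := N ++ translates L x in
    [/\ 0 < r', r' <= r / 2,
        {in L, forall v, ball (h v) r (h (v + x)) /\ ball (h v) r (h (v - x))},
        {in N', forall v k, v <> d k} &
        {in N', forall v k, (k <= n)%N -> ~ ball (h v) (3 * r') (h (d k))}].
Proof.
move=> r0 Nd.
have L0 : \forall x \near (0 : X), {in L, forall v,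
    ball (h v) r (h (v + x)) /\ ball (h v) r (h (v - x))}.
  by apply: near_seq => v _; exact: near_translate.
(* The forbidden values: solutions [x] of [v + x = d k] or [v - x = d k]. *)
pose Q := \bigcup_(v in [set` L]) \bigcup_(k in [set: nat])
  ([set d k - v] `|` [set v - d k]).
have cQ : countable Q.
  apply: bigcup_countable => [|v _]; first exact: finite_set_countable.
  apply: bigcup_countable => // k _.
  by apply: finite_set_countable; rewrite finite_setU.
have [x Lx Qx] := near_countable X_sep X_unc L0 cQ.
have N'd : {in N ++ translates L x, forall v k, v <> d k}.
  move=> v; rewrite !mem_cat.
  move=> /or3P[/Nd //|/mapP[w Lw ->]|/mapP[w Lw ->]] k wk.
    apply: Qx; exists w => //; exists k => //.
    by left; rewrite /= -wk addrC addKr.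
  apply: Qx; exists w => //; exists k => //.
  by right; rewrite /= -wk subKr.
pose s := [seq (h v, h (d k)) | v <- N ++ translates L x, k <- iota 0 n.+1].
have [e e0 se] : exists2 e : R, 0 < e & {in s, forall p, ~ ball p.1 e p.2}.
  apply: ball_separate_seq => p /allpairsP[[v k] [/= vN _ ->]] /h_inj.
  exact: N'd.
(* Here [r / 2] gives the halving, and [e / 3] keeps the tripled radius below the gap [e]. *)
exists x, (Num.min (r / 2) (e / 3)); split=> //.
- by rewrite lt_min !divr_gt0.
- by rewrite ge_min lexx.
- move=> v vN k kn vk; apply: (se (h v, h (d k))).
    by apply: allpairs_f => //; rewrite mem_iota.
  apply: le_ball vk.
  have : Num.min (r / 2) (e / 3) <= e / 3 by rewrite ge_min lexx orbT.
  by lra.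
Qed.

Lemma signed_sums_seq :
  exists (x : nat -> X) (r : nat -> R) (L N : nat -> seq X),
    [/\ L 0%N = [:: 0] /\ N 0%N = [::],
        forall n, L n.+1 = L n ++ translates (L n) (x n),
        forall n, N n.+1 = N n ++ translates (L n) (x n),
        (forall n, 0 < r n) /\ (forall n, r n.+1 <= r n / 2) &
        forall n,
        {in L n, forall v,
          ball (h v) (r n) (h (v + x n)) /\ ball (h v) (r n) (h (v - x n))} /\
        {in N n, forall v k, (k < n)%N -> ~ ball (h v) (3 * r n) (h (d k))}].
Proof.
pose St := (seq X * seq X * R)%type.
pose Inv (s : St) := 0 < s.2 /\ {in s.1.2, forall v k, v <> d k}.
pose next (s : St) x r' : St :=
  (s.1.1 ++ translates s.1.1 x, s.1.2 ++ translates s.1.1 x, r').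
(* The invariant is a premise under the existential, so that [choice] applies to all states;
   [(0, 0)] is a dummy for bad ones. *)
have step (ns : nat * St) : exists xr : X * R, Inv ns.2 ->
   [/\ Inv (next ns.2 xr.1 xr.2), xr.2 <= ns.2.2 / 2,
     {in ns.2.1.1, forall v, ball (h v) ns.2.2 (h (v + xr.1)) /\
        ball (h v) ns.2.2 (h (v - xr.1))} &
     {in (next ns.2 xr.1 xr.2).1.2, forall v k, (k <= ns.1)%N ->
        ~ ball (h v) (3 * xr.2) (h (d k))}].
  have [[r0 Nd]|nI] := pselect (Inv ns.2); last by exists (0, 0).
  have [x [r' [? ? ? ? ?]]] := signed_sums_step ns.1 ns.2.1.1 r0 Nd.
  by exists (x, r').
have [T TP] := choice step.
pose S := fix S n : St := if n is m.+1 then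
   let xr := T (m, S m) in next (S m) xr.1 xr.2 else ([:: 0], [::], 1).
have SI n : Inv (S n).
  elim: n => [|n IHn]; first by split => //=; exact: ltr01.
  by have [] := TP (n, S n) IHn.
exists (fun n => (T (n, S n)).1), (fun n => (S n).2).
exists (fun n => (S n).1.1), (fun n => (S n).1.2); split=> //.
- split=> n; first by have [] := SI n.
  by have [] := TP (n, S n) (SI n).
- move=> n; split; first by have [] := TP (n, S n) (SI n).
  case: n => [//|n] v vN k; rewrite ltnS => kn.
  by have [_ _ _] := TP (n, S n) (SI n); exact.
Qed.

End signed_sums.

(** * Subset sums and their differences *)

Definition subset_sum (X : zmodType) (x : nat -> X) (e : nat -> bool)
    (n : nat) : X :=
  \sum_(i < n) x i *+ e i.

(* L n consists of the signed sums of x 0, ..., x n.-1, and N n of those whose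
   coefficients are not all zero. *)
Lemma subset_sum_diff (X : topologicalZmodType) (x : nat -> X)
    (L N : nat -> seq X) :
  L 0%N = [:: 0] -> N 0%N = [::] ->
  (forall n, L n.+1 = L n ++ translates (L n) (x n)) ->
  (forall n, N n.+1 = N n ++ translates (L n) (x n)) ->
  forall e e' n, let D n := subset_sum x e n - subset_sum x e' n in
   [/\ D n \in L n,
       D n.+1 \in [:: D n; D n + x n; D n - x n] &
       forall i, (i < n)%N -> e i != e' i -> D n \in N n].
Proof.
move=> L0 N0 LS NS e e' n D.
have DS m : D m.+1 = D m + (x m *+ e m - x m *+ e' m).
  by rewrite /D /subset_sum !big_ord_recr /= opprD addrACA.
have DL m : D m \in L m.
  elim: m => [|m IHm].
    by rewrite L0 /D /subset_sum !big_ord0 subrr mem_head.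
  have [DD DB] := mem_translates (x m) IHm.
  rewrite LS DS mem_cat; case: (e m); case: (e' m);
    rewrite ?subrr ?addr0 ?subr0 ?sub0r ?IHm //; last by rewrite DB orbT.
  by rewrite DD orbT.
split=> //.
  by rewrite DS !inE; case: (e n); case: (e' n);
    rewrite ?subrr ?addr0 ?subr0 ?sub0r ?eqxx ?orbT.
have DN m : e m != e' m -> D m.+1 \in N m.+1.
  have [DD DB] := mem_translates (x m) (DL m).
  rewrite DS NS mem_cat; case: (e m) (e' m) => -[] // _.
    by rewrite subr0 DD orbT.
  by rewrite sub0r DB orbT.
(* If [e] and [e'] agree at the last index, the difference does not change and stays in the prefix
   [N n] of [N n.+1]; otherwise [DN] applies. *)
elim: n => [//|n IHn] i; rewrite ltnS leq_eqVlt => /predU1P[->|ilt] ne.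
  exact: DN.
have [ee'|/DN //] := eqVneq (e n) (e' n).
by rewrite DS NS mem_cat ee' subrr addr0 (IHn i).
Qed.

(** * The limit map on the Cantor space *)

Lemma inj_hausdorff (T U : topologicalType) (f : T -> U) :
  continuous f -> injective f -> hausdorff_space U -> hausdorff_space T.
Proof.
move=> cf fI hU p q pq; apply: fI; apply: hU => A B fA fB.
by have [z [Az Bz]] := pq _ _ (cf p _ fA) (cf q _ fB); exists (f z).
Qed.

Lemma near_eq_prefix (e : cantor_space) (n : nat) :
  \forall e' \near e, forall i, (i < n)%N -> e' i = e i.
Proof.
have H : \forall e' \near e, forall i : 'I_n, e' (val i) = e (val i).
  apply: (@filter_forall _ _ _ _ (nbhs_filter e)) => i.
  exact: (@proj_continuous nat (fun=> bool) (val i) e _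
    (discrete_set1 (e (val i)))).
by apply: filterS H => e' He i lt_in; exact: (He (Ordinal lt_in)).
Qed.

(** [F e] is the limit of the subset sums of [e]. The error bound [FD] yields both the continuity of
    [F] and the avoidance of each [d k]. *)
Lemma independent_cantor (R : realType) (X : topologicalZmodType)
    (d : nat -> X) :
  polish R X -> ~ countable [set: X] ->
  exists2 F : cantor_space -> X, continuous F &
    forall e e', e <> e' -> forall k, F e - F e' <> d k.
Proof.
move=> [sX [M cM [h [hi [hK hiK ch chi]]]]] uX.
have [x [r [L [N [[L0 N0] LS NS [r0 rh] LN]]]]] :=
  signed_sums_seq d ch (can_inj hK) sX uX.
pose D e e' n := subset_sum x e n - subset_sum x e' n.
have DP e e' n := subset_sum_diff L0 N0 LS NS e e' n.
have Dball e e' n : ball (h (D e e' n)) (r n) (h (D e e' n.+1)).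
  have [/(LN n).1 [bD bB] + _] := DP e e' n.
  rewrite -!/(D _ _ _) !inE => /or3P[] /eqP -> //.
  exact: ballxx.
(* Subtracting the empty sum turns subset sums into differences, to which [Dball] applies. *)
pose o (_ : nat) := false.
have Do e n : D e o n = subset_sum x e n.
  by rewrite /D [X in _ - X]big1 ?subr0.
have Fex (e : cantor_space) : exists l : X, subset_sum x e @ \oo --> l.
  have [m Dm] := cM _ (halving_cauchy r0 rh (Dball e o)).
  exists (hi m).
  have -> : subset_sum x e = hi \o (fun n => h (D e o n)).
    by apply/funext => n /=; rewrite hK Do.
  by apply: continuous_cvg; [exact: chi|exact: Dm].
have [F FP] := choice Fex.
have FD e e' n : ball (h (D e e' n)) (3 * r n) (h (F e - F e')).
  apply: (halving_lim r0 rh (Dball e e')).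
  apply: continuous_cvg; first exact: ch.
  by apply: (@continuous2_cvg _ _ _ _ _ _ _ _ (fun a b : X => a - b));
    [exact: (@sub_continuous X (F e, F e'))|exact: FP|exact: FP].
have Fo : F o = 0.
  apply: cvg_unique (FP o) _.
    exact: inj_hausdorff ch (can_inj hK) (@metric_hausdorff _ M).
  have -> : subset_sum x o = fun=> 0 by apply/funext => n; exact: big1.
  exact: cvg_cst.
exists F.
  have -> : F = hi \o (h \o F) by apply/funext => e /=; rewrite hK.
  move=> e; apply: continuous_comp; last exact: chi.
  apply/cvg_ballP => eps eps0.
  (* [F e] and [F e'] both lie within [3 * r n] of the common partial sum, whence 6. *)
  have [n rn] := halving_small r0 rh (divr_gt0 eps0 (ltr0n R 6)).
  have := near_eq_prefix e n; apply: filterS => e' ee'.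
  have ss : subset_sum x e' n = subset_sum x e n.
    by apply: eq_bigr => i _; rewrite ee'.
  have := FD e o n; have := FD e' o n; rewrite Fo !subr0 !Do ss.
  move=> b' /ball_sym b.
  by apply: le_ball (ball_triangle b b'); lra.
move=> e e' /eqP ne k Fk.
have [i ei] : exists i, e i != e' i.
  apply: contrapT => /forallNP ee'; move/eqP: ne; apply.
  by apply/funext => i; apply/eqP; apply: contra_notT (ee' i).
(* This stage exceeds [i], so the difference lies in [N], and exceeds [k], so the gap to [d k] is in
   force; [FD] contradicts it. *)
have [_ _ /(_ i)] := DP e e' (maxn i k).+1.
rewrite -/(D _ _ _) ltnS leq_maxl => /(_ isT ei) /(LN _).2 /(_ k).
rewrite ltnS leq_maxr => /(_ isT); apply; rewrite -Fk; exact: FD.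
Qed.

(** * Application to a countable set *)

Lemma countable_enum (T : Type) (A : set T) : countable A -> A !=set0 ->
  exists d : nat -> T, A `<=` range d.
Proof.
move=> cA [a Aa]; have [A0|[f]] := pfcard_geP cA; first by rewrite A0 in Aa.
by exists f => y Ay; exact: (@surj _ _ _ _ f).
Qed.

Theorem proposition3p1 (R : realType) (X : topologicalZmodType)
    (X_polish : polish R X) (X_uncountable : ~ countable [set: X])
    (A : set X) (A_countable : countable A) :
  haar1 A.
Proof.
have hX : hausdorff_space X.
  have [_ [M _ [h [hi [hK _ ch _]]]]] := X_polish.
  exact: inj_hausdorff ch (can_inj hK) (@metric_hausdorff _ M).
(* The point 0 gives the injectivity of [F], and also makes [Q] nonempty when [A] is empty. *)
pose Q := [set 0] `|` \bigcup_(a in A) \bigcup_(b in A) [set a - b].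
have cQ : countable Q.
  rewrite /Q -bigcup2E; apply: bigcup_countable => // -[|[|i]] _ //=.
  by do 2! apply: bigcup_countable => // ? _; exact: countable1.
have [d Qd] := countable_enum cQ (ex_intro _ 0 (or_introl erefl)).
have [F cF FP] := independent_cantor d X_polish X_uncountable.
have QF e e' : Q (F e - F e') -> e = e'.
  move=> /Qd [k _ dk]; apply: contrapT => /FP /(_ k); exact.
exists A, (range F); split=> //.
- exact: countable_borel.
- apply: cantor_copy_range => // e e' ee'.
  by apply: QF; left; rewrite /= ee' subrr.
move=> x _ _ [[_ [e _ <-] <-] Ae] [[_ [e' _ <-] <-] Ae'].
(* The translation by [x] cancels in the difference of the two points, which therefore lies in
   [A - A]. *)
congr (F _ + x); apply: QF; right.
exists (F e + x) => //; exists (F e' + x) => //=.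
by rewrite opprD addrACA subrr addr0.
Qed.
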